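(* Let $w=(w(n))_{n\in\mathbb{N}}$ be a bounded, strictly positive sequence such that $\mathsf{C}$ maps $\ell_1(w)$ into itself and $\mathsf{C}^{(1,w)}\colon\ell_1(w)\to\ell_1(w)$ is compact. Then the following properties hold. (i) $\sigma_{pt}(\mathsf{C}^{(1,w)})=\Sigma$ and $\sigma(\mathsf{C}^{(1,w)})=\Sigma_0$. (ii) $w\in s$.
   Context: The discrete Cesàro operator $\mathsf{C}\colon\mathbb{C}^{\mathbb{N}}\to\mathbb{C}^{\mathbb{N}}$ is the linear map $\mathsf{C}x:=\left(\frac{x_1+\dots+x_n}{n}\right)_{n\in\mathbb{N}}$ for $x=(x_n)_{n\in\mathbb{N}}$, with $\mathbb{N}=\{1,2,\dots\}$. For a bounded, strictly positive sequence $w$, $\ell_1(w):=\{x\in\mathbb{C}^{\mathbb{N}}\colon \sum_{n=1}^\infty w(n)|x_n|<\infty\}$, a Banach space for the norm $\|x\|_{1,w}:=\sum_{n=1}^\infty w(n)|x_n|$. $\mathsf{C}^{(1,w)}$ denotes the restriction of $\mathsf{C}$ to $\ell_1(w)$. $\sigma(T)$ and $\sigma_{pt}(T)$ denote the spectrum and the set of eigenvalues of a continuous linear operator $T$. Further, $\Sigma:=\{\frac1m\colon m\in\mathbb{N}\}$, $\Sigma_0:=\Sigma\cup\{0\}$, and $s$ is the space of rapidly decreasing sequences, i.e., of all $x\in\mathbb{C}^{\mathbb{N}}$ with $(n^kx_n)_{n\in\mathbb{N}}\in\ell_1$ for every $k\in\mathbb{N}$. *)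

(* Defs.v *)
From HB Require Import structures.
From mathcomp Require Import all_boot all_order all_algebra.
From mathcomp Require Import mathcomp_extra boolp classical_sets functions.
From mathcomp Require Import reals topology normedtype sequences.
From mathcomp Require Import complex.

Set Implicit Arguments.
Unset Strict Implicit.
Unset Printing Implicit Defensive.

Import Order.TTheory GRing.Theory Num.Theory.
Import numFieldNormedType.Exports.

Local Open Scope classical_set_scope.
Local Open Scope ring_scope.
Local Open Scope complex_scope.

(* Sequences indexed by N = {1, 2, ...} are represented by functions on nat
   shifted by one: [x n] is the term of index n + 1. *)

Section operators.
Variables (K : numFieldType) (X Y : normedModType K).

Definition compact_operator (T : {linear X -> Y}) : Prop :=
  forall A : set X, bounded_set A -> precompact (T @` A).

Definition point_spectrum (T : {linear X -> X}) : set K :=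
  [set l | exists2 x : X, x != 0 & T x = l *: x].

Definition resolvent_set (T : {linear X -> X}) : set K :=
  [set l | exists S : {linear X -> X},
     [/\ continuous S,
         cancel (fun x => l *: x - T x) S &
         cancel S (fun x => l *: x - T x)]].

Definition spectrum (T : {linear X -> X}) : set K := ~` resolvent_set T.

End operators.

Section weighted_ell1.
Variable R : realType.
Implicit Types (w : nat -> R) (x y : nat -> R[i]).

Definition weighted_summand w x : nat -> R := fun n => w n * Normc.normc (x n).

Definition weighted_summable w x : Prop := cvgn (series (weighted_summand w x)).

Definition in_ell1 x : Prop := weighted_summable (fun=> 1) x.

Definition rapidly_decreasing x : Prop :=
  forall k, (0 < k)%N -> in_ell1 (fun n => n.+1%:R ^+ k * x n).

Definition cesaro_mean x : nat -> R[i] :=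
  fun n => (\sum_(i < n.+1) x i) / n.+1%:R.

Definition Sigma : set R[i] := [set l | exists2 m, (0 < m)%N & l = m%:R^-1].

Definition Sigma0 : set R[i] := Sigma `|` [set 0].

Lemma normcD (a b : R[i]) :
  Normc.normc (a + b) <= Normc.normc a + Normc.normc b.
Proof. exact: (@le_normcD R a b). Qed.

Lemma normc_ge0 (a : R[i]) : 0 <= Normc.normc a.
Proof. by case: a => a b; exact: sqrtr_ge0. Qed.

Section positive_weight.
Variables (w : nat -> R) (w_gt0 : forall n, 0 < w n).

Lemma weighted_summand_ge0 x n : 0 <= weighted_summand w x n.
Proof. by rewrite mulr_ge0 ?normc_ge0// ltW. Qed.

Lemma weighted_summandZ (a : R[i]) x :
  weighted_summand w (fun n => a * x n) =
  Normc.normc a *: (weighted_summand w x : nat -> R).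
Proof.
by apply/funext => n; rewrite /weighted_summand Normc.normcM mulrCA.
Qed.

Lemma weighted_summandD x y n :
  weighted_summand w (fun n => x n + y n) n <=
  weighted_summand w x n + weighted_summand w y n.
Proof. by rewrite -mulrDr ler_pM2l ?normcD. Qed.

Lemma weighted_summable0 : weighted_summable w (fun=> 0).
Proof.
rewrite /weighted_summable (_ : weighted_summand _ _ = fun=> 0); last first.
  by apply/funext => n; rewrite /weighted_summand Normc.normc0 mulr0.
rewrite (_ : series _ = fun=> 0); last first.
  by apply/funext => n; rewrite /series/= big1.
exact: is_cvg_cst.
Qed.

Lemma weighted_summableZ (a : R[i]) x :
  weighted_summable w x -> weighted_summable w (fun n => a * x n).
Proof.
by rewrite /weighted_summable weighted_summandZ; exact: is_cvg_seriesZ.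
Qed.

Lemma weighted_summableD x y : weighted_summable w x ->
  weighted_summable w y -> weighted_summable w (fun n => x n + y n).
Proof.
move=> sx sy; apply: (@series_le_cvg R _
  (weighted_summand w x + weighted_summand w y)).
- exact: weighted_summand_ge0.
- by move=> n; rewrite addr_ge0 ?weighted_summand_ge0.
- exact: weighted_summandD.
- exact: is_cvg_seriesD.
Qed.

End positive_weight.
End weighted_ell1.

Section ell1_space.
Variables (R : realType) (w : nat -> R) (w_gt0 : forall n, 0 < w n).

(* The positivity proof is a parameter of the space so that the instances below
   (which need it for the triangle inequality and the separation axiom) can be
   attached to it. *)
Definition ell1_pred of (forall n, 0 < w n) : {pred nat -> R[i]} :=
  [pred x | `[< weighted_summable w x >]].

Lemma ell1_submod_closed : submod_closed (ell1_pred w_gt0).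
Proof.
split; first by apply/asboolP; exact: weighted_summable0.
move=> a x y /asboolP sx /asboolP sy; apply/asboolP.
by apply: weighted_summableD => //; exact: weighted_summableZ.
Qed.

HB.instance Definition _ :=
  GRing.isSubmodClosed.Build _ _ (ell1_pred w_gt0) ell1_submod_closed.

Record ell1 := Ell1 {
  ell1_seq :> nat -> R[i];
  ell1_seqP : ell1_seq \in ell1_pred w_gt0 }.

HB.instance Definition _ := [isSub for ell1_seq].
HB.instance Definition _ := [Choice of ell1 by <:].
HB.instance Definition _ := [SubChoice_isSubLmodule of ell1 by <:].

Lemma ell1_summable (x : ell1) : weighted_summable w x.
Proof. by apply/asboolP; exact: (ell1_seqP x). Qed.

(* The norm of a normed module over [R[i]] takes its values in [R[i]]. *)
Definition ell1_norm (x : ell1) : R[i] :=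
  (limn (series (weighted_summand w x)))%:C.

Lemma ell1_normD (x y : ell1) :
  ell1_norm (x + y) <= ell1_norm x + ell1_norm y.
Proof.
rewrite /ell1_norm -rmorphD/= lecR.
have sx := @ell1_summable x; have sy := @ell1_summable y.
rewrite -(lim_seriesD sx sy); apply: (@lim_series_le R
  (weighted_summand w (fun n => x n + y n))
  (weighted_summand w x + weighted_summand w y)).
- exact: weighted_summableD.
- exact: is_cvg_seriesD.
- exact: weighted_summandD.
Qed.

Lemma ell1_normZ (a : R[i]) (x : ell1) : ell1_norm (a *: x) = `|a| * ell1_norm x.
Proof.
rewrite /ell1_norm (weighted_summandZ w a x) lim_seriesZ; last first.
  exact: ell1_summable.
by case: a => a b; rewrite -[LHS]/((_ * _)%:C) rmorphM.
Qed.

Lemma ell1_norm_eq0 (x : ell1) : ell1_norm x = 0 -> x = 0.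
Proof.
move=> /eqP; rewrite eq_complex/= eqxx andbT => /eqP x0.
apply/val_inj/funext => n /=; apply: Normc.eq0_normc.
have s_ge0 := weighted_summand_ge0 w_gt0 x.
have : series (weighted_summand w x) n.+1 <= 0.
  rewrite -x0; apply: nondecreasing_cvgn_le; last exact: ell1_summable.
  exact: nondecreasing_series.
rewrite seriesSr => le0.
have : weighted_summand w x n <= 0.
  apply: le_trans le0; rewrite lerDr /series/=.
  by apply: sumr_ge0.
move=> le0n; have /eqP : weighted_summand w x n = 0.
  by apply/eqP; rewrite eq_le le0n s_ge0.
by rewrite mulf_eq0 gt_eqF//= => /eqP.
Qed.

HB.instance Definition _ := Lmodule_isNormed.Build R[i] ell1
  ell1_normD ell1_normZ ell1_norm_eq0.

Section cesaro_operator.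
Hypothesis cesaro_ell1_stable : forall x : nat -> R[i],
  weighted_summable w x -> weighted_summable w (cesaro_mean x).

Lemma cesaro_ell1_subproof (x : ell1) : cesaro_mean x \in ell1_pred w_gt0.
Proof. by apply/asboolP/cesaro_ell1_stable/ell1_summable. Qed.

Definition cesaro_ell1 (x : ell1) : ell1 := Ell1 (cesaro_ell1_subproof x).

Lemma cesaro_ell1_is_linear : linear cesaro_ell1.
Proof.
move=> a x y; apply/val_inj/funext => n /=; rewrite /cesaro_mean /=.
rewrite -[RHS]/(a * ((\sum_(i < n.+1) x i) / n.+1%:R) +
  (\sum_(i < n.+1) y i) / n.+1%:R).
by rewrite mulrA -mulrDl mulr_sumr -big_split.
Qed.

HB.instance Definition _ := GRing.isLinear.Build R[i] ell1 ell1 _ cesaro_ell1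
  cesaro_ell1_is_linear.

End cesaro_operator.
End ell1_space.

Arguments ell1_summable {R w w_gt0} x.
Arguments cesaro_ell1 {R w} w_gt0 cesaro_ell1_stable x.

(* Main.v *)
(* Write C for the Cesaro operator. It is lower triangular with diagonal entries
   1/n, so l - C is injective on the space of all sequences unless l = 1/m for
   some m, in which case its kernel is spanned by the binomials 'C(n - 1, m - 1);
   the point is to know which sequences lie in l_1(w).
   Compactness makes the norm of C restricted to the sequences vanishing below N
   tend to 0 with N. Truncations commute with lower triangularity, so for l != 0
   this small restriction gives an a priori bound of the truncated norms of any
   sequence x by those of (l - C) x and finitely many coordinates of x. Hence
   (l - C) x in l_1(w) forces x in l_1(w). Applied to the binomials, this gives
   the eigenvectors and w in s; applied to the formal solution of (l - C) x = y,
   it gives the resolvent. *)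

Require Import Defs.
From HB Require Import structures.
From mathcomp Require Import all_boot all_order all_algebra.
From mathcomp Require Import mathcomp_extra boolp classical_sets functions.
From mathcomp Require Import reals topology normedtype sequences.
From mathcomp Require Import complex.
From mathcomp Require Import ring lra.
Import Order.TTheory GRing.Theory Num.Theory.
Import numFieldNormedType.Exports.
Local Open Scope classical_set_scope.
Local Open Scope ring_scope.
Local Open Scope complex_scope.

Set Implicit Arguments.
Unset Strict Implicit.

Local Notation normc := (@Normc.normc _).

(** * The complex modulus *)

Lemma normc_natr (R : realType) n : normc (n%:R : R[i]) = n%:R :> R.
Proof.
by rewrite -(rmorph_nat (real_complex R)) /= expr0n addr0 sqrtr_sqr normr_nat.
Qed.

Lemma normc_norm (R : realType) (z : R[i]) : `|z| = (normc z)%:C.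
Proof. by rewrite normc_def; case: z. Qed.

Lemma normc_gt0 (R : realType) (a : R[i]) : a != 0 -> 0 < normc a.
Proof.
move=> a0; rewrite lt_neqAle normc_ge0 andbT eq_sym.
by apply: contra a0 => /eqP/Normc.eq0_normc ->.
Qed.

Lemma normc_sum (R : realType) (x : nat -> R[i]) n :
  normc (\sum_(i < n) x i) <= \sum_(i < n) normc (x i).
Proof.
elim: n => [|n IHn]; first by rewrite !big_ord0 Normc.normc0.
by rewrite !big_ord_recr/= (le_trans (normcD _ _))// lerD2r.
Qed.

(** * Truncated weighted norms *)

Section partial_norm.
Context {R : realType}.
Variables (w : nat -> R) (w_gt0 : forall n, 0 < w n).
Implicit Types x y : nat -> R[i].

(** Arbitrary sequences are allowed, so that estimates can be made before summability is known. *)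
Definition partial_norm x M : R := \sum_(n < M) w n * normc (x n).

Lemma partial_normE x : partial_norm x = series (weighted_summand w x).
Proof. by apply/funext => M; rewrite /series /= big_mkord. Qed.

Lemma partial_norm_ge0 x M : 0 <= partial_norm x M.
Proof. by apply: sumr_ge0 => i _; exact: weighted_summand_ge0. Qed.

Lemma partial_norm_nondecreasing x :
  {homo partial_norm x : n m / (n <= m)%N >-> n <= m}.
Proof.
by rewrite partial_normE; apply: nondecreasing_series => n _ _;
  exact: weighted_summand_ge0.
Qed.

Lemma eq_partial_norm x y M :
  (forall n, (n < M)%N -> x n = y n) -> partial_norm x M = partial_norm y M.
Proof. by move=> xy; apply: eq_bigr => i _; rewrite xy. Qed.

Lemma partial_normD x y M :
  partial_norm (fun n => x n + y n) M <= partial_norm x M + partial_norm y M.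
Proof.
by rewrite -big_split; apply: ler_sum => i _; exact: weighted_summandD.
Qed.

Lemma partial_normZ a x M :
  partial_norm (fun n => a * x n) M = normc a * partial_norm x M.
Proof.
by rewrite mulr_sumr; apply: eq_bigr => i _; rewrite Normc.normcM mulrCA.
Qed.

Lemma partial_norm_bounded_summable x K :
  (forall M, partial_norm x M <= K) -> weighted_summable w x.
Proof.
move=> xK; rewrite /weighted_summable -partial_normE.
apply: nondecreasing_is_cvgn; first exact: partial_norm_nondecreasing.
by exists K => _ [n _ <-].
Qed.

Lemma partial_norm_le_lim x M : weighted_summable w x ->
  partial_norm x M <= limn (series (weighted_summand w x)).
Proof.
rewrite /weighted_summable -partial_normE => cx.
by apply: nondecreasing_cvgn_le => //; exact: partial_norm_nondecreasing.
Qed.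

Lemma lim_le_partial_norm x K : weighted_summable w x ->
  (forall M, partial_norm x M <= K) ->
  limn (series (weighted_summand w x)) <= K.
Proof.
rewrite /weighted_summable -partial_normE => cx xK.
by apply: limr_le => //; exact: nearW.
Qed.

Lemma finite_support_partial_norm N x : (forall n, (N <= n)%N -> x n = 0) ->
  forall M, partial_norm x M <= partial_norm x N.
Proof.
move=> x0 M; have [MN|NM] := leqP M N; first exact: partial_norm_nondecreasing.
rewrite /partial_norm -(subnKC (ltnW NM)) big_split_ord/= gerDl big1// => i _.
by rewrite x0 ?leq_addr// Normc.normc0 mulr0.
Qed.

Lemma finite_support_summable N x :
  (forall n, (N <= n)%N -> x n = 0) -> weighted_summable w x.
Proof.
by move=> /finite_support_partial_norm; exact: partial_norm_bounded_summable.
Qed.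

End partial_norm.

(** * Lower triangular structure of the Cesaro operator *)

Section cesaro_mean.
Context {R : realType}.
Implicit Types x y : nat -> R[i].

Definition resolvent_map (l : R[i]) x : nat -> R[i] :=
  fun n => l * x n - cesaro_mean x n.

Lemma eq_cesaro_mean x y n :
  (forall k, (k <= n)%N -> x k = y k) -> cesaro_mean x n = cesaro_mean y n.
Proof.
by move=> xy; congr (_ / _); apply: eq_bigr => i _; rewrite xy// -ltnS.
Qed.

Lemma cesaro_meanD x y n :
  cesaro_mean (fun k => x k + y k) n = cesaro_mean x n + cesaro_mean y n.
Proof. by rewrite -mulrDl -big_split. Qed.

(** Isolates the diagonal entry of row [n]; where it is nonzero, [x n] follows from the earlier
    coordinates by forward substitution. *)
Lemma resolvent_map_sum l x n :
  (l - n.+1%:R^-1) * x n = resolvent_map l x n + (\sum_(i < n) x i) / n.+1%:R.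
Proof.
by rewrite /resolvent_map /cesaro_mean big_ord_recr/=; ring.
Qed.

End cesaro_mean.

(** * Norm and coordinates in l_1(w) *)

Section ell1_theory.
Context {R : realType} {w : nat -> R}.
Variable w_gt0 : forall n, 0 < w n.

Local Notation lnorm x := (limn (series (weighted_summand w x))).

Lemma ell1_normrE (x : ell1 w_gt0) : `|x| = (lnorm x)%:C.
Proof. by []. Qed.

Lemma ell1_lnorm_ge0 (x : ell1 w_gt0) : 0 <= lnorm x.
Proof. by have := normr_ge0 x; rewrite ell1_normrE lecR. Qed.

Lemma ell1_lnorm_gt0 (x : ell1 w_gt0) : x != 0 -> 0 < lnorm x.
Proof. by rewrite -normr_gt0 ell1_normrE ltcR. Qed.

Lemma le_coord_ell1_norm (x : ell1 w_gt0) n : w n * normc (x n) <= lnorm x.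
Proof.
apply: le_trans (partial_norm_le_lim w_gt0 n.+1 (ell1_summable x)).
by rewrite /partial_norm big_ord_recr/= lerDr partial_norm_ge0.
Qed.

Definition to_ell1 (x : nat -> R[i]) (sx : weighted_summable w x) : ell1 w_gt0 :=
  Ell1 (introT (asboolP _) sx : x \in ell1_pred w_gt0).

End ell1_theory.

(** * A priori bounds from compactness *)

Section compactness.
Context {R : realType} {w : nat -> R}.
Variable w_gt0 : forall n, 0 < w n.
Variable cesaro_stable : forall x : nat -> R[i],
  weighted_summable w x -> weighted_summable w (cesaro_mean x).
Hypothesis cesaro_compact : compact_operator (cesaro_ell1 w_gt0 cesaro_stable).

Local Notation C := (cesaro_ell1 w_gt0 cesaro_stable).
Local Notation lnorm x := (limn (series (weighted_summand w x))).

(* A cluster point of the images of unit vectors [u N] with [u N] vanishing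
   below [N] has all its coordinates equal to zero. *)
Lemma compact_cesaro_tail (e : R) : 0 < e ->
  exists N, forall x : ell1 w_gt0, (forall n, (n < N)%N -> x n = 0) ->
    lnorm (C x) <= e * lnorm x.
Proof.
move=> e0; apply: contrapT => noN.
(* Normalising a counterexample for each [N] gives a sequence [u] in the unit ball. *)
have /choice[u uP] : forall N, exists u : ell1 w_gt0,
    [/\ forall n, (n < N)%N -> u n = 0, lnorm u <= 1 & e < lnorm (C u)].
  move=> N; move/forallNP : noN => /(_ N) /existsNP[x /not_implyP[xN xe]].
  have x0 : x != 0.
    apply: contra_notN xe => /eqP ->; rewrite linear0.
    by rewrite (_ : lnorm _ = 0) ?mulr0//; have := @normr0 _ (ell1 w_gt0);
      rewrite ell1_normrE => -[].
  have nx := ell1_lnorm_gt0 x0.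
  have normV (z : ell1 w_gt0) : lnorm ((lnorm x)^-1%:C *: z) = (lnorm x)^-1 * lnorm z.
    apply: complexI; rewrite rmorphM/=.
    rewrite -[LHS]/(`|_ *: z|) normrZ -ell1_normrE normc_norm/=.
    by rewrite expr0n addr0 sqrtr_sqr gtr0_norm// invr_gt0.
  exists ((lnorm x)^-1%:C *: x); split.
  - by move=> n nN; rewrite -[LHS]/(_ * x n) xN// mulr0.
  - by rewrite normV mulVf// gt_eqF.
  - by rewrite linearZ normV mulrC ltr_pdivlMr// ltNge; apply/negP.
pose A := [set x : ell1 w_gt0 | lnorm x <= 1].
have /cesaro_compact : bounded_set A.
  exists 1; split; first exact: real1.
  move=> M M1 x /= xA; apply: le_trans (ltW M1).
  by rewrite ell1_normrE -[1]/(1%:C) lecR.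
rewrite precompactE => /(_ ((C \o u) @ \oo)) [].
  by exists 0%N => // N _; apply: subset_closure; exists (u N) => //; case: (uP N).
move=> p [_ clp].
(* Clustering along [\oo]: images of arbitrarily large index come close to [p]. *)
have near_p (d : R) k : 0 < d -> exists2 N, (k <= N)%N & lnorm (p - C (u N)) < d.
  move=> d0; have /= := clp ((C \o u) @` [set N | (k <= N)%N]) (ball p d%:C).
  case.
  - by exists k => // N /= kN; exists N.
  - by apply: nbhsx_ballx; rewrite ltcR.
  - move=> _ [[N /= kN <-]]; rewrite -ball_normE/= ell1_normrE ltcR.
    by exists N.
have p0 : p = 0.
  apply/val_inj/funext => k; apply: Normc.eq0_normc => /=.
  (* Inserts the nonzero factor [w k], because the norm controls [w k * normc (p k)]. *)
  apply/eqP; rewrite -[_ == _]orFb -(gt_eqF (w_gt0 k)) -mulf_eq0.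
  rewrite eq_le; apply/andP; split; last by rewrite mulr_ge0 ?normc_ge0 ?ltW.
  apply/ler_addgt0Pl => d d0; rewrite addr0.
  have [N kN /ltW] := near_p d k.+1 d0; apply: le_trans.
  apply: le_trans (le_coord_ell1_norm _ k); rewrite -[(p - _) k]/(p k - _).
  have [uN _ _] := uP N; rewrite [X in p k - X](_ : _ = 0) ?subr0//=.
  rewrite /cesaro_mean big1 ?mul0r// => i _; apply: uN.
  exact: leq_trans (ltn_ord i) kN.
have [N _] := near_p e 0%N e0; rewrite p0 sub0r.
have [_ _] := uP N; rewrite -ltcR -(ltcR _ e) -!ell1_normrE normrN.
by move=> /lt_trans /[apply]; rewrite ltxx.
Qed.

(** Reaches sequences outside l_1(w): cutting [x] off at [M] changes neither its first [M]
    coordinates nor their means. *)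
Lemma compact_cesaro_tail_partial (e : R) : 0 < e ->
  exists N, forall x, (forall n, (n < N)%N -> x n = 0) ->
    forall M, partial_norm w (cesaro_mean x) M <= e * partial_norm w x M.
Proof.
move=> e0; have [N NP] := compact_cesaro_tail e0; exists N => x xN M.
pose y n := if (n < M)%N then x n else 0.
have y0 n : (M <= n)%N -> y n = 0 by rewrite /y leqNgt => /negbTE ->.
pose z := to_ell1 w_gt0 (finite_support_summable w_gt0 y0).
have zN n : (n < N)%N -> z n = 0 by rewrite /= /y; case: ifP => // _ /xN.
rewrite (@eq_partial_norm _ _ _ (C z)); last first.
  move=> n nM; apply: eq_cesaro_mean => k kn /=.
  by rewrite /y (leq_ltn_trans kn nM).
rewrite (le_trans (partial_norm_le_lim w_gt0 M (ell1_summable _)))//.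
rewrite (le_trans (NP z zN))// ler_pM2l//.
have -> : partial_norm w x M = partial_norm w y M.
  by apply: eq_partial_norm => n nM; rewrite /y nM.
apply: lim_le_partial_norm; first exact: (ell1_summable z).
exact: finite_support_partial_norm.
Qed.

(** Split [x = h + z] at index [N]. In [l z = (l - C) x - l h + C h + C z], the tail bound makes
    [C z] cost at most half of [l z], which the left side absorbs. *)
Lemma partial_norm_resolvent_map l : l != 0 -> exists N, exists2 K, 0 <= K &
  forall x M, partial_norm w x M <=
    K * (partial_norm w (resolvent_map l x) M + \sum_(i < N) normc (x i)).
Proof.
move=> /normc_gt0 l0; have [|N NP] := @compact_cesaro_tail_partial (normc l / 2).
  by rewrite divr_gt0.
pose d (n : nat) : R[i] := (n == 0%N)%:R.
(* The mean of the first unit vector [d] is [1 / (n + 1)], so stability of l_1(w) makes the sum [S]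
   of all [w n / (n + 1)] finite. *)
have sCd : weighted_summable w (cesaro_mean d).
  by apply/cesaro_stable/(finite_support_summable w_gt0 (N := 1)) => -[].
have Cd n : normc (cesaro_mean d n) = n.+1%:R^-1.
  rewrite /cesaro_mean big_ord_recl big1 ?addr0 ?mul1r; last first.
    by move=> i _; rewrite /d.
  by rewrite Normc.normcV normc_natr.
pose S := lnorm (cesaro_mean d).
have S0 : 0 <= S by exact: (ell1_lnorm_ge0 (to_ell1 w_gt0 sCd)).
pose W := \sum_(i < N) w i.
have W0 : 0 <= W by apply: sumr_ge0 => i _; exact: ltW.
(* One [W] comes from the norm of [h]; the bound on [z] gives the other two and the terms in
   [2 / normc l]. *)
exists N, (2 / normc l + 3 * W + 2 * S / normc l) => [|x M].
  by rewrite !addr_ge0// ?mulr_ge0// invr_ge0 ltW.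
set r := partial_norm w (resolvent_map l x) M; set H := \sum_(i < N) _.
have r0 : 0 <= r by exact: partial_norm_ge0.
have H0 : 0 <= H by apply: sumr_ge0 => i _; exact: normc_ge0.
pose h n := if (n < N)%N then x n else 0.
pose z n := if (n < N)%N then 0 else x n.
have hz n : x n = h n + z n by rewrite /h /z; case: ifP; rewrite ?addr0 ?add0r.
have h0 n : (N <= n)%N -> h n = 0 by rewrite /h leqNgt => /negbTE ->.
have sum_h n : \sum_(i < n) normc (h i) <= H.
  have := @finite_support_partial_norm _ (fun=> 1) (fun=> ltr01) _ _ h0 n.
  rewrite /partial_norm; under eq_bigr do rewrite mul1r.
  move/le_trans; apply; rewrite le_eqVlt; apply/orP; left; apply/eqP.
  by apply: eq_bigr => i _; rewrite mul1r /h ltn_ord.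
have normh : partial_norm w h M <= W * H.
  rewrite (le_trans (finite_support_partial_norm w_gt0 h0 M))//.
  rewrite mulr_suml; apply: ler_sum => i _; rewrite ler_pM2l//.
  rewrite /h ltn_ord /H (bigD1 i)//= lerDl.
  by apply: sumr_ge0 => j _; exact: normc_ge0.
(* Termwise, the mean of [h] is at most [H / (n + 1)], that is, [H] times the mean of [d]. *)
have normCh : partial_norm w (cesaro_mean h) M <= S * H.
  apply: (@le_trans _ _ (partial_norm w (cesaro_mean d) M * H)); last first.
    by rewrite ler_wpM2r// partial_norm_le_lim.
  rewrite mulr_suml; apply: ler_sum => i _; rewrite -mulrA ler_pM2l//.
  rewrite Cd /cesaro_mean Normc.normcM Normc.normcV normc_natr mulrC.
  by rewrite ler_pM2l ?invr_gt0// (le_trans (normc_sum _ _)).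
have normCz : partial_norm w (cesaro_mean z) M <= normc l / 2 * partial_norm w z M.
  by apply: NP => n nN; rewrite /z nN.
have xhz : partial_norm w x M <= partial_norm w h M + partial_norm w z M.
  by rewrite (eq_partial_norm w (fun n _ => hz n)) partial_normD.
have : normc l * partial_norm w z M <= r +
    (normc l * partial_norm w h M + (partial_norm w (cesaro_mean h) M +
     partial_norm w (cesaro_mean z) M)).
  rewrite -partial_normZ (@eq_partial_norm _ _ _ (fun n => resolvent_map l x n +
    (- l * h n + (cesaro_mean h n + cesaro_mean z n)))); last first.
    move=> n _; rewrite -cesaro_meanD /resolvent_map hz.
    by rewrite (eq_cesaro_mean (fun k _ => hz k)); ring.
  rewrite (le_trans (partial_normD w_gt0 _ _ _))// lerD2l.
  rewrite (le_trans (partial_normD w_gt0 _ _ _))//.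
  by rewrite partial_normZ (@normcN R l) lerD2l partial_normD.
set Z := partial_norm w z M in normCz xhz *.
set P := partial_norm w h M in normh xhz *.
move=> lZ; have {lZ}Zle : Z <= 2 / normc l * r + 2 * P + 2 * S / normc l * H.
  rewrite -(ler_pM2l l0).
  have -> : normc l * (2 / normc l * r + 2 * P + 2 * S / normc l * H) =
    2 * (r + (normc l * P + S * H)) by field; rewrite gt_eqF.
  by nra.
rewrite (le_trans xhz)// (le_trans (lerD normh Zle))//.
(* Expanding [K * (r + H)] leaves nonnegative cross terms to discard. *)
have q0 : 0 < (normc l)^-1 by rewrite invr_gt0.
have a0 : 0 <= 2 / normc l * H by rewrite !mulr_ge0// ltW.
have b0 : 0 <= W * r by rewrite mulr_ge0.
have c0 : 0 <= 2 * S / normc l * r by rewrite !mulr_ge0// ltW.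
by nra.
Qed.

(** The a priori bound is uniform in [M], so the truncated norms of [x] stay bounded. *)
Lemma resolvent_map_summable l x : l != 0 ->
  weighted_summable w (resolvent_map l x) -> weighted_summable w x.
Proof.
move=> /partial_norm_resolvent_map[N [K K0 NK]] sr.
apply: (partial_norm_bounded_summable w_gt0 (K :=
  K * (lnorm (resolvent_map l x) + \sum_(i < N) normc (x i)))) => M.
rewrite (le_trans (NK x M))// ler_wpM2l// lerD2r.
exact: partial_norm_le_lim.
Qed.

(** Forward substitution by induction on [N]; this removes the finitely many coordinates from the a
    priori bound. *)
Lemma sum_normc_resolvent_map (l : R[i]) N : (forall n, l != n.+1%:R^-1) ->
  exists2 c : R, 0 <= c & forall x : nat -> R[i],
    \sum_(i < N) normc (x i) <= c * partial_norm w (resolvent_map l x) N.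
Proof.
move=> ln; elim: N => [|N [c c0 IHN]].
  by exists 0 => // x; rewrite big_ord0 mul0r.
have dN : 0 < normc (l - N.+1%:R^-1) by rewrite normc_gt0// subr_eq0.
(* In the new row, [(w N)^-1] undoes the weight and the inner [c] bounds the preceding
   coordinates. *)
exists (c + ((w N)^-1 + c) / normc (l - N.+1%:R^-1)) => [|x].
  by rewrite addr_ge0// divr_ge0 ?addr_ge0 ?invr_ge0// ltW.
have r0 : 0 <= partial_norm w (resolvent_map l x) N by exact: partial_norm_ge0.
set r := partial_norm w (resolvent_map l x) N in r0.
set t := normc (resolvent_map l x N).
have -> : partial_norm w (resolvent_map l x) N.+1 = r + w N * t.
  by rewrite /partial_norm big_ord_recr.
have t0 : 0 <= t by exact: normc_ge0.
rewrite big_ord_recr/= mulrDl lerD//.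
  by rewrite (le_trans (IHN x))// ler_wpM2l// lerDl mulr_ge0// ltW.
rewrite mulrAC ler_pdivlMr// mulrC -Normc.normcM resolvent_map_sum.
rewrite (le_trans (normcD _ _))// mulrDl -/t.
have -> : (w N)^-1 * (r + w N * t) = (w N)^-1 * r + t.
  by rewrite mulrDr mulKf// gt_eqF.
rewrite -addrA addrCA lerD2l.
rewrite Normc.normcM Normc.normcV normc_natr.
apply: (@le_trans _ _ (c * r)); last first.
  rewrite mulrDr addrCA lerDl addr_ge0// !mulr_ge0// ?invr_ge0 ltW//.
rewrite (le_trans _ (IHN x))// (le_trans _ (normc_sum _ _))//.
by rewrite ler_piMr ?normc_ge0// invf_le1// ler1n.
Qed.

(** This estimate becomes the continuity of the inverse of [l - C]. *)
Lemma resolvent_map_bounded_below (l : R[i]) : l != 0 -> (forall n, l != n.+1%:R^-1) ->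
  exists2 K, 0 <= K & forall x, weighted_summable w x ->
    weighted_summable w (resolvent_map l x) ->
    lnorm x <= K * lnorm (resolvent_map l x).
Proof.
move=> /partial_norm_resolvent_map[N [K K0 NK]] /(sum_normc_resolvent_map N).
move=> [c c0 cP]; exists (K * (1 + c)) => [|x sx sr].
  by rewrite mulr_ge0// addr_ge0.
apply: lim_le_partial_norm => // M; rewrite (le_trans (NK x M))// -mulrA.
rewrite ler_wpM2l// mulrDl mul1r lerD// ?partial_norm_le_lim//.
by rewrite (le_trans (cP x))// ler_wpM2l// partial_norm_le_lim.
Qed.

End compactness.

(** * Formal solution of (l - C) x = y *)

Section formal_resolvent.
Context {R : realType}.
Variable l : R[i].
Hypothesis l_neq : forall n, l != n.+1%:R^-1.
Implicit Types x y : nat -> R[i].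

(** Sum of the first [n] coordinates of the solution; carrying the sum keeps the recursion
    structural. *)
Fixpoint resolvent_partial_sum y n : R[i] :=
  if n is n'.+1 then
    let s := resolvent_partial_sum y n' in
    s + (y n' + s / n'.+1%:R) / (l - n'.+1%:R^-1)
  else 0.

Definition formal_resolvent y n : R[i] :=
  (y n + resolvent_partial_sum y n / n.+1%:R) / (l - n.+1%:R^-1).

Lemma sum_formal_resolvent y n :
  \sum_(i < n) formal_resolvent y i = resolvent_partial_sum y n.
Proof. by elim: n => [|n IHn]; rewrite ?big_ord0// big_ord_recr/= IHn. Qed.

Lemma formal_resolventK y n : resolvent_map l (formal_resolvent y) n = y n.
Proof.
have := resolvent_map_sum l (formal_resolvent y) n.
rewrite sum_formal_resolvent {1}/formal_resolvent mulrC divfK ?subr_eq0//.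
by move/addIr.
Qed.

(** No diagonal entry vanishes, so strong induction determines every coordinate, without
    summability. *)
Lemma resolvent_map_inj x y :
  (forall n, resolvent_map l x n = resolvent_map l y n) -> x = y.
Proof.
move=> xy; apply/funext => n; elim/ltn_ind: n => n IHn.
have ln : l - n.+1%:R^-1 != 0 by rewrite subr_eq0.
apply: (mulfI ln); rewrite !resolvent_map_sum xy; congr (_ + _ / _).
by apply: eq_bigr => i _; exact: IHn.
Qed.

End formal_resolvent.

(** * Binomial sequences as formal eigenvectors *)

Lemma sum_bin m n : (\sum_(i < n) 'C(i, m) = 'C(n, m.+1))%N.
Proof.
by elim: n => [|n IHn]; rewrite ?big_ord0// big_ord_recr/= IHn binS.
Qed.

(** The hockey-stick sum is ['C(n + 1, m + 1)], and [(m + 1) 'C(n + 1, m + 1) = (n + 1) 'C(n,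
    m)]. *)
Lemma cesaro_mean_bin (R : realType) m n :
  cesaro_mean (fun k => 'C(k, m)%:R) n = m.+1%:R^-1 * 'C(n, m)%:R :> R[i].
Proof.
rewrite /cesaro_mean -natr_sum sum_bin.
have m0 k : k.+1%:R != 0 :> R[i] by rewrite pnatr_eq0.
apply: (mulfI (m0 m)); rewrite mulrA -natrM -mul_bin_diag mulVKf// natrM.
by rewrite mulrC mulKf.
Qed.

(** * Eigenvalues, decay of the weight, and spectrum *)

Section spectra.
Context {R : realType} {w : nat -> R}.
Variable w_gt0 : forall n, 0 < w n.
Variable cesaro_stable : forall x : nat -> R[i],
  weighted_summable w x -> weighted_summable w (cesaro_mean x).
Hypothesis cesaro_compact : compact_operator (cesaro_ell1 w_gt0 cesaro_stable).

Local Notation C := (cesaro_ell1 w_gt0 cesaro_stable).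

(** The sequence is sent to 0 by [1 / (m + 1) - C], and summability passes back from the image. *)
Lemma bin_summable m : weighted_summable w (fun n => 'C(n, m)%:R).
Proof.
have m0 : m.+1%:R^-1 != 0 :> R[i] by rewrite invr_eq0 pnatr_eq0.
apply: (resolvent_map_summable cesaro_compact m0).
have -> : resolvent_map m.+1%:R^-1 (fun n => 'C(n, m)%:R) = fun=> 0 :> R[i].
  by apply/funext => n; rewrite /resolvent_map cesaro_mean_bin subrr.
exact: weighted_summable0.
Qed.

Lemma weight_rapidly_decreasing : rapidly_decreasing (fun n => (w n)%:C).
Proof.
(* [(n + 1) 'C(n, m)] is a combination of ['C(n, m)] and ['C(n, m + 1)]. *)
have pow_bin k m : weighted_summable w (fun n => n.+1%:R ^+ k * 'C(n, m)%:R).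
  elim: k m => [|k IHk] m.
    by under eq_fun do rewrite expr0 mul1r; exact: bin_summable.
  rewrite (_ : (fun n => _) = fun n => m.+1%:R * (n.+1%:R ^+ k * 'C(n, m.+1)%:R)
    + m.+1%:R * (n.+1%:R ^+ k * 'C(n, m)%:R)); last first.
    apply/funext => n; rewrite exprSr -mulrA -natrM -[n in 'C(n, m)]/(n.+1.-1).
    by rewrite mul_bin_diag binS natrM natrD/=; ring.
  by apply: (weighted_summableD w_gt0); exact: weighted_summableZ.
(* For [m = 0] the binomial is 1, and the weight [w] can trade places with the sequence. *)
move=> k _; rewrite /in_ell1 /weighted_summable (_ : weighted_summand _ _ =
  weighted_summand w (fun n => n.+1%:R ^+ k * 'C(n, 0)%:R)); first exact: pow_bin.
apply/funext => n; rewrite /weighted_summand bin0 mulr1 mul1r Normc.normcM mulrC.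
by congr (_ * _); rewrite /= expr0n addr0 sqrtr_sqr gtr0_norm.
Qed.

Lemma resolvent_mapE (l : R[i]) (x : ell1 w_gt0) :
  (l *: x - C x : nat -> R[i]) = resolvent_map l x.
Proof. by []. Qed.

Lemma Sigma_eigenvalue : @Sigma R `<=` point_spectrum C.
Proof.
move=> _ [[//|m] _ ->]; exists (to_ell1 w_gt0 (bin_summable (m := m))).
  apply/eqP => /(congr1 (fun x : ell1 w_gt0 => x m)) /= /eqP.
  by rewrite binn oner_eq0.
by apply/val_inj/funext => n /=; rewrite cesaro_mean_bin.
Qed.

Lemma eigenvalue_Sigma : point_spectrum C `<=` @Sigma R.
Proof.
move=> l [x x0 Cx]; apply: contrapT => lS.
have ln n : l != n.+1%:R^-1 by apply/eqP => ln; apply: lS; exists n.+1.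
move/eqP: x0; apply; apply/val_inj; apply: (resolvent_map_inj ln) => n.
rewrite -resolvent_mapE Cx subrr /resolvent_map /cesaro_mean /=.
by rewrite big1// mul0r mulr0 subrr.
Qed.

Lemma eigenvalue_in_spectrum : point_spectrum C `<=` spectrum C.
Proof.
move=> l [x x0 Cx] [S [_ SK _]]; move/eqP: x0; apply.
by rewrite -(SK x) Cx subrr linear0.
Qed.

(* The only preimage of the unit vector [e n] is [(n + 1) (e n - e (n + 1))],
   so the inverse would have norm at least [n + 1] for all [n]. *)
Lemma spectrum0 : spectrum C 0.
Proof.
move=> [S [Sc SK _]].
have /linear_boundedP[K [Kr KP]] := continuous_linear_bounded 0 (Sc 0).
have [k Kk] : exists k : nat, K < k%:R :> R[i].
  exists (Num.truncn (normc K)).+1; apply: le_lt_trans (real_ler_norm Kr) _.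
  by rewrite normc_norm -(rmorph_nat (real_complex R)) ltcR truncnS_gt.
pose d (n : nat) : R[i] := (n == k)%:R.
pose z (n : nat) : R[i] := k.+1%:R * ((n == k)%:R - (n == k.+1)%:R).
have d0 n : (k.+1 <= n)%N -> d n = 0 by rewrite /d; case: ltngtP.
have z0 n : (k.+2 <= n)%N -> z n = 0.
  by move=> kn; rewrite /z !gtn_eqF ?subrr ?mulr0// ltnW.
pose a := to_ell1 w_gt0 (finite_support_summable w_gt0 d0).
pose b := to_ell1 w_gt0 (finite_support_summable w_gt0 z0).
have sum_delta m n : \sum_(i < n) (val i == m)%:R = (m < n)%:R :> R[i].
  elim: n => [|n IHn]; first by rewrite big_ord0.
  by rewrite big_ord_recr/= IHn ltnS; case: ltngtP; rewrite ?addr0 ?add0r.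
have Cb : C b = a.
  apply/val_inj/funext => n /=; rewrite /cesaro_mean -mulr_sumr sumrB !sum_delta.
  rewrite /d !ltnS; case: ltngtP => [||->]; rewrite ?subrr ?mulr0 ?mul0r//.
  by rewrite subr0 mulr1 divff// pnatr_eq0.
have Sa : S (- a) = b by rewrite -[RHS]SK scale0r sub0r -Cb.
have := KP _ Kk (- a); rewrite Sa normrN !ell1_normrE.
rewrite -(rmorph_nat (real_complex R)) -rmorphM lecR.
apply/negP; rewrite -ltNge.
(* Coordinate [k] of [b] alone contributes [(k + 1) w k], which exceeds [k] times the norm [w k] of
   [a]. *)
apply: lt_le_trans (le_coord_ell1_norm b k).
rewrite /= /z eqxx -[k == k.+1]negbK neq_ltn ltnSn subr0 mulr1 normc_natr mulrC.
apply: (@le_lt_trans _ _ (w k * k%:R)); last by rewrite ltr_pM2l// ltr_nat.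
rewrite ler_wpM2r//; apply: lim_le_partial_norm; first exact: (ell1_summable a).
move=> M; rewrite (le_trans (finite_support_partial_norm w_gt0 d0 M))//.
rewrite /partial_norm big_ord_recr/= big1 => [|i _].
  by rewrite add0r /d eqxx Normc.normc1 mulr1.
by rewrite /d ltn_eqF// Normc.normc0 mulr0.
Qed.

Lemma resolvent_notin_Sigma0 (l : R[i]) : ~ @Sigma0 R l -> resolvent_set C l.
Proof.
move=> lS; have l0 : l != 0 by apply/eqP => l0; apply: lS; right.
have ln n : l != n.+1%:R^-1 by apply/eqP => ln; apply: lS; left; exists n.+1.
have fK (y : ell1 w_gt0) : resolvent_map l (formal_resolvent l y) = y.
  by apply/funext => n; exact: formal_resolventK.
have sf (y : ell1 w_gt0) : weighted_summable w (formal_resolvent l y).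
  apply: (resolvent_map_summable cesaro_compact l0); rewrite fK.
  exact: ell1_summable.
pose S y := to_ell1 w_gt0 (sf y).
have SK : cancel S (fun x => l *: x - C x).
  by move=> y; apply: val_inj; exact: fK.
have KS : cancel (fun x => l *: x - C x) S.
  move=> x; apply: val_inj; apply: (resolvent_map_inj ln) => n.
  by rewrite -resolvent_mapE SK.
have S_linear : linear S.
  (* Linearity is checked after applying the injective map [l - C]. *)
  move=> a x y; apply: (can_inj KS); rewrite SK [C _]linearP scalerDr.
  rewrite -[in LHS](SK x) -[in LHS](SK y) scalerBr !scalerA mulrC opprD.
  by rewrite [LHS]addrACA.
pose Slin : {linear ell1 w_gt0 -> ell1 w_gt0} :=
  HB.pack S (GRing.isLinear.Build _ _ _ _ S S_linear).
exists Slin; split=> //.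
apply: bounded_linear_continuous; apply/linear_boundedP.
have [K K0 KP] := resolvent_map_bounded_below cesaro_compact l0 ln.
exists K%:C; split; first by apply: ger0_real; rewrite lecR.
move=> r Kr y; apply: (@le_trans _ _ (K%:C * `|y|)).
  rewrite !ell1_normrE -rmorphM lecR.
  have := KP (S y) (sf y); rewrite fK; apply; exact: ell1_summable.
by rewrite ler_wpM2r// ltW.
Qed.

End spectra.

Unset Implicit Arguments.
Set Strict Implicit.

Theorem proposition3p11 (R : realType) (w : nat -> R)
    (w_gt0 : forall n, 0 < w n) (w_bounded : bounded_fun w)
    (cesaro_stable : forall x : nat -> R[i],
       weighted_summable w x -> weighted_summable w (cesaro_mean x)) :
  compact_operator (cesaro_ell1 w_gt0 cesaro_stable) ->
  (point_spectrum (cesaro_ell1 w_gt0 cesaro_stable) = @Sigma R /\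
   spectrum (cesaro_ell1 w_gt0 cesaro_stable) = @Sigma0 R) /\
  rapidly_decreasing (fun n => (w n)%:C).
Proof.
move=> cesaro_compact; split; last exact: weight_rapidly_decreasing.
have point_eq : point_spectrum (cesaro_ell1 w_gt0 cesaro_stable) = @Sigma R.
  by apply/seteqP; split; [exact: eigenvalue_Sigma|exact: Sigma_eigenvalue].
split=> //; apply/seteqP; split=> [l|l [lS|->]].
- by apply: contra_notP; exact: resolvent_notin_Sigma0.
- by apply: eigenvalue_in_spectrum; rewrite point_eq.
- exact: spectrum0.
Qed.
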